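(* Let $X$ be a countable set, let $f:X\to X$ be a map satisfying the bounded condition with respect to a partition $X=X_1\sqcup\cdots\sqcup X_k$, and let $T_1,\dots,T_k\in\mathcal{B}(\mathcal{H})$ be the associated partial isometries. If $f$ satisfies the totally uniqueness condition, then the injective, order-preserving map $$K\longmapsto \mathcal{H}_K:=\overline{\operatorname{span}\{e_x\mid x\in K\}}\qquad(\mathcal{H}_\emptyset=\{0\})$$ from the family of all $f$-invariant subsets $K\subseteq X$ to the family of all reducing subspaces $\mathcal{M}\subseteq\mathcal{H}$ for $C^*(T_1,\dots,T_k)$ is bijective.
   Context: Let $X$ be a countable (finite or countably infinite) set, without topology, and $f:X\to X$ a map (not necessarily injective or surjective). Bounded condition: $f$ satisfies the bounded condition if there are $k\in\mathbb{N}$ and mutually disjoint subsets $X_1,\dots,X_k$ of $X$ with $\bigcup_{i=1}^k X_i=X$ such that each restriction $f|_{X_i}$ is injective. Such a partition is fixed. Associated operators: $\mathcal{H}$ is a complex Hilbert space with $\dim\mathcal{H}=|X|$ and complete orthonormal system $\{e_x\}_{x\in X}$; $\mathcal{B}(\mathcal{H})$ is the algebra of bounded linear operators on $\mathcal{H}$. For $1\le i\le k$, $T_i\in\mathcal{B}(\mathcal{H})$ is the partial isometry with $T_ie_x=e_{f(x)}$ if $x\in X_i$ and $T_ie_x=0$ if $x\notin X_i$. $C^*(T_1,\dots,T_k)$ is the $C^*$-subalgebra of $\mathcal{B}(\mathcal{H})$ generated by $T_1,\dots,T_k$. $f$-invariant set: a subset $K\subseteq X$ with $f(K)\subseteq K$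 and $f^{-1}(K)\subseteq K$ (the empty set is allowed). Reducing subspace for a set $\mathcal{S}\subseteq\mathcal{B}(\mathcal{H})$: a closed subspace $\mathcal{M}\subseteq\mathcal{H}$ with $T\mathcal{M}\subseteq\mathcal{M}$ and $T^*\mathcal{M}\subseteq\mathcal{M}$ for every $T\in\mathcal{S}$. Totally uniqueness condition: for $x\in X$ and $j\in\mathbb{N}=\{1,2,\dots\}$ let $i_j\in\{1,\dots,k\}$ be the unique index with $f^{j-1}(x)\in X_{i_j}$ ($f^0=\mathrm{id}_X$), and put $\hat{x}=(i_1,i_2,i_3,\dots)\in\{1,\dots,k\}^{\mathbb{N}}$. The map $f$ satisfies the totally uniqueness condition (with respect to the fixed partition) if $X\ni x\mapsto\hat{x}\in\{1,\dots,k\}^{\mathbb{N}}$ is injective. *)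

(* Defs.v *)
From HB Require Import structures.
From mathcomp Require Import all_boot all_order all_algebra.
From mathcomp Require Import sesquilinear complex.
From mathcomp Require Import all_classical all_reals all_analysis.
Import Order.TTheory GRing.Theory Num.Theory.
Import numFieldNormedType.Exports.

Set Implicit Arguments.
Unset Strict Implicit.
Unset Printing Implicit Defensive.

Local Open Scope classical_set_scope.
Local Open Scope ring_scope.
Local Open Scope complex_scope.

Section Dynamics.
Variables (X : countType) (f : X -> X).

(* The indices 1, ..., k are represented by 'I_k; pieces may be empty. *)
Record bounded_partition (k : nat) := BoundedPartition {
  piece :> 'I_k -> set X ;
  piece_disjoint : trivIset setT piece ;
  piece_cover : \bigcup_i piece i = setT ;
  piece_inj : forall i, set_inj (piece i) f }.

Lemma piece_exists k (P : bounded_partition k) (x : X) : exists i, P i x.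
Proof.
have : (\bigcup_i P i) x by rewrite piece_cover.
by move=> [i _ Pix]; exists i.
Qed.

Definition piece_index k (P : bounded_partition k) (x : X) : 'I_k :=
  sval (cid (piece_exists P x)).

(* Sequences are indexed from 0: the term of rank j >= 1 of the itinerary,
   given by the piece containing f^(j-1)(x), is stored at index j - 1. *)
Definition itinerary k (P : bounded_partition k) (x : X) : nat -> 'I_k :=
  fun j => piece_index P (iter j f x).

Definition totally_unique k (P : bounded_partition k) : Prop :=
  injective (itinerary P).

Definition f_invariant (K : set X) : Prop :=
  f @` K `<=` K /\ f @^-1` K `<=` K.

End Dynamics.

(* In [normedModType R[i]] norms take values in R[i]; they are nonnegative,
   hence real.  The inner product is linear in its first argument. *)
Section Operators.
Variables (R : realType) (H : completeNormedModType R[i]).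

(* With H complete, this makes (H, dot) a complex Hilbert space. *)
Definition hilbert_dot (dot : {dot H for Num.conj}) : Prop :=
  forall v : H, `|v| ^+ 2 = dot v v.

Definition lspan (S : set H) : set H :=
  [set v | exists (n : nat) (a : 'I_n -> R[i]) (u : 'I_n -> H),
    (forall i, S (u i)) /\ v = \sum_(i < n) a i *: u i].

Definition complete_orthonormal (dot : {dot H for Num.conj})
    (X : countType) (e : X -> H) : Prop :=
  (forall x y, dot (e x) (e y) = (x == y)%:R) /\
  closure (lspan (range e)) = setT.

Definition bounded_operator : set (H -> H) :=
  [set T | linear T /\ exists M : R, forall v, `|T v| <= M%:C * `|v|].

Definition opnorm (T : H -> H) : R :=
  sup [set complex.Re `|T v| | v in [set v : H | `|v| <= 1]].

(* S = T^*.  For bounded T such an S is unique because dot is definite, and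
   exists (and is bounded) by the Riesz representation theorem. *)
Definition is_adjoint (dot : {dot H for Num.conj}) (T S : H -> H) : Prop :=
  forall u v, dot (T u) v = dot u (S v).

(* No unit is required. *)
Record cstar_subalgebra (dot : {dot H for Num.conj}) (A : set (H -> H)) : Prop :=
  CStarSubalgebra {
    cstar_bounded : A `<=` bounded_operator ;
    cstar0 : A (fun=> 0) ;
    cstarD : forall S T, A S -> A T -> A (fun v => S v + T v) ;
    cstarZ : forall (a : R[i]) T, A T -> A (fun v => a *: T v) ;
    cstarM : forall S T, A S -> A T -> A (S \o T) ;
    cstar_adjoint : forall T S, A T -> bounded_operator S ->
      is_adjoint dot T S -> A S ;
    cstar_closed : forall T, bounded_operator T ->
      (forall eps : R, 0 < eps ->
         exists2 S, A S & opnorm (fun v => T v - S v) < eps) ->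
      A T }.

(* [smallest] is the intersection of all C*-subalgebras containing G. *)
Definition Cstar (dot : {dot H for Num.conj}) (G : set (H -> H)) :
  set (H -> H) := smallest (cstar_subalgebra dot) G.

Definition closed_subspace (M : set H) : Prop :=
  [/\ closed M, M 0 & forall (a : R[i]) u v, M u -> M v -> M (a *: u + v)].

Definition reducing_subspace (dot : {dot H for Num.conj}) (G : set (H -> H))
    (M : set H) : Prop :=
  closed_subspace M /\
  forall T, G T -> T @` M `<=` M /\
    forall S, bounded_operator S -> is_adjoint dot T S -> S @` M `<=` M.

Definition associated_operators (X : countType) (f : X -> X) (e : X -> H)
    (k : nat) (P : bounded_partition f k) (T : 'I_k -> H -> H) : Prop :=
  forall i, bounded_operator (T i) /\
    forall x, (P i x -> T i (e x) = e (f x)) /\ (~ P i x -> T i (e x) = 0).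

Definition coordinate_subspace (X : countType) (e : X -> H) (K : set X) :
  set H := closure (lspan (e @` K)).

End Operators.

(* Main.v *)
(** The words in the T_i and their adjoints contain T_w^* T_w, the projection onto
    the closed span of the e_x whose itinerary starts with w.  When itineraries
    separate points, letting w run through the prefixes of the itinerary of x
    gives projections converging strongly to the one onto e_x.  Hence a reducing
    subspace M contains e_x as soon as some vector of M has a nonzero coordinate
    at x, so that M = H_K for K = {x | e_x in M}. *)

Require Import Defs.
From HB Require Import structures.
From mathcomp Require Import all_boot all_order all_algebra.
From mathcomp Require Import sesquilinear complex.
From mathcomp Require Import all_classical all_reals all_analysis.
Import Order.TTheory GRing.Theory Num.Theory.
Import numFieldNormedType.Exports.

Set Implicit Arguments.
Unset Strict Implicit.
Unset Printing Implicit Defensive.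

Local Open Scope classical_set_scope.
Local Open Scope ring_scope.
Local Open Scope complex_scope.

(** * Closed subspaces and bounded operators *)

Section HilbertSpace.
Variables (R : realType) (H : completeNormedModType R[i]).
Local Notation C := R[i].
Implicit Types (u v w : H) (A M N : set H) (T S Q : H -> H).

(** In [R[i]] the condition [0 < eps] forces [eps] to be real, so these are the usual metric
    balls. *)
Lemma closure_normP A v :
  closure A v <-> forall eps : C, 0 < eps -> exists2 u, A u & `|v - u| < eps.
Proof.
split=> [Av eps e0|Av B /nbhs_ballP[eps /= e0 epsB]].
  have [u [Au]] := Av _ (nbhsx_ballx v _ e0).
  by rewrite -ball_normE /ball_ /= => vu; exists u.
have [u Au vu] := Av _ e0.
by exists u; split => //; apply: epsB; rewrite -ball_normE.
Qed.

(** For nonzero [a], taking [eps = |a| / (c + 1)] would give [c + 1 <= c]. Equalities are passed to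
    limits in this way. *)
Lemma norm_le_small_eq0 (V : normedZmodType C) (a : V) (c : C) :
  0 <= c -> (forall eps : C, 0 < eps -> `|a| <= c * eps) -> a = 0.
Proof.
move=> c0 ac; apply/eqP; rewrite -normr_le0 -[_ <= 0]negbK; apply/negP => a0.
have {}a0 : 0 < `|a| by rewrite normr_gt0; apply: contra a0 => /eqP ->; rewrite normr0.
have d0 : 0 < c + 1 by rewrite ltr_wpDl.
have := ac (`|a| / (c + 1)) (divr_gt0 a0 d0).
rewrite mulrA ler_pdivlMr // mulrC ler_pM2r // => /le_lt_trans => /(_ (c + 1)).
by rewrite ltrDl ltr01 ltxx => /(_ isT).
Qed.

Lemma closed_subspaceD M u v : closed_subspace M -> M u -> M v -> M (u + v).
Proof. by case=> _ _ Mlin Mu Mv; rewrite -[u]scale1r; exact: Mlin. Qed.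

Lemma closed_subspaceZ M (a : C) u : closed_subspace M -> M u -> M (a *: u).
Proof. by case=> _ M0 Mlin Mu; rewrite -[_ *: _]addr0; exact: Mlin. Qed.

Lemma closed_subspace_limit M v : closed_subspace M ->
  (forall eps : C, 0 < eps -> exists2 u, M u & `|v - u| < eps) -> M v.
Proof. by case=> cM _ _ /closure_normP; exact: cM. Qed.

Lemma lspan_sub M (G : set H) : closed_subspace M -> G `<=` M -> lspan G `<=` M.
Proof.
move=> sM GM _ [n [a [u [Gu ->]]]]; elim/big_ind: _.
- by case: sM.
- by move=> *; exact: closed_subspaceD.
- by move=> i _; apply: closed_subspaceZ => //; exact: GM.
Qed.

Lemma closure_lspan_sub M (G : set H) :
  closed_subspace M -> G `<=` M -> closure (lspan G) `<=` M.
Proof.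
move=> sM GM v /closure_normP Gv; apply: closed_subspace_limit => // eps e0.
by have [u Gu vu] := Gv _ e0; exists u => //; exact: lspan_sub Gu.
Qed.

Lemma closed_subspace_set0 : closed_subspace [set (0 : H)].
Proof.
split=> //; last by move=> a u v /= -> ->; rewrite scaler0 addr0.
move=> v /closure_normP v0; apply: (@norm_le_small_eq0 _ _ 1) => // eps e0.
by have [_ -> ] := v0 _ e0; rewrite subr0 mul1r => /ltW.
Qed.

Section BoundedOperators.
Variables (T : H -> H) (bT : bounded_operator T).

Lemma bounded_operatorD u v : T (u + v) = T u + T v.
Proof. by case: bT => linT _; rewrite -[u]scale1r linT !scale1r. Qed.

Lemma bounded_operator0 : T 0 = 0.
Proof. by apply: (addrI (T 0)); rewrite -bounded_operatorD !addr0. Qed.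

Lemma bounded_operatorZ (a : C) u : T (a *: u) = a *: T u.
Proof.
by case: bT => linT _; rewrite -[_ *: u]addr0 linT bounded_operator0 addr0.
Qed.

Lemma bounded_operatorB u v : T (u - v) = T u - T v.
Proof. by rewrite bounded_operatorD -scaleN1r bounded_operatorZ scaleN1r. Qed.

Lemma bounded_operator_sum n (a : 'I_n -> C) (u : 'I_n -> H) :
  T (\sum_(i < n) a i *: u i) = \sum_(i < n) a i *: T (u i).
Proof.
under [RHS]eq_bigr do rewrite -bounded_operatorZ.
exact: (big_morph T bounded_operatorD bounded_operator0).
Qed.

(** Enlarging a bound [c] to [|c| + 1] makes it safe to divide by. *)
Lemma bounded_operator_gt0 : exists2 c : R, 0 < c & forall v, `|T v| <= c%:C * `|v|.
Proof.
case: bT => _ [c cT]; exists (`|c| + 1); first by rewrite ltr_wpDl.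
move=> v; apply: (le_trans (cT v)); rewrite ler_wpM2r // lecR.
by rewrite (le_trans (ler_norm c)) // lerDl.
Qed.

Lemma closed_subspace_preimage N : closed_subspace N -> closed_subspace (T @^-1` N).
Proof.
move=> sN; split.
- move=> v /closure_normP Nv /=; apply: closed_subspace_limit => // eps e0.
  have [c c0 cT] := bounded_operator_gt0.
  have c0' : 0 < c%:C by rewrite ltcR.
  have [u Nu vu] := Nv (eps / c%:C) (divr_gt0 e0 c0').
  exists (T u) => //; rewrite -bounded_operatorB (le_lt_trans (cT _)) //.
  by rewrite mulrC -ltr_pdivlMr.
- by rewrite /= bounded_operator0; case: sN.
- move=> a u v /= Nu Nv; rewrite bounded_operatorD bounded_operatorZ.
  by case: sN => _ _; exact.
Qed.

End BoundedOperators.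

Lemma bounded_operator_id : bounded_operator (@id H).
Proof. by split => //; exists 1 => v; rewrite mul1r. Qed.

Lemma bounded_operator_comp T S :
  bounded_operator T -> bounded_operator S -> bounded_operator (T \o S).
Proof.
move=> bT bS; have [c c0 cT] := bounded_operator_gt0 bT.
have [d d0 dS] := bounded_operator_gt0 bS; split.
  move=> a u v /=.
  by rewrite (bounded_operatorD bS) (bounded_operatorZ bS)
             (bounded_operatorD bT) (bounded_operatorZ bT).
exists (c * d) => v /=; rewrite (le_trans (cT _)) // rmorphM -mulrA.
by rewrite ler_pM2l ?ltcR.
Qed.

Lemma bounded_operator_scale (a : C) T :
  bounded_operator T -> bounded_operator (fun v => a *: T v).
Proof.
move=> bT; have [c c0 cT] := bounded_operator_gt0 bT; split.
  move=> b u v; rewrite (bounded_operatorD bT) (bounded_operatorZ bT).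
  by rewrite scalerDr !scalerA mulrC.
exists (complex.Re `|a| * c) => v; rewrite normrZ rmorphM /= -mulrA.
have -> : (complex.Re `|a|)%:C = `|a| by rewrite RRe_real // normr_real.
by rewrite ler_wpM2l.
Qed.

Lemma bounded_operator_add T S : bounded_operator T -> bounded_operator S ->
  bounded_operator (fun v => T v + S v).
Proof.
move=> bT bS; have [c c0 cT] := bounded_operator_gt0 bT.
have [d d0 dS] := bounded_operator_gt0 bS; split.
  move=> b u v; rewrite (bounded_operatorD bT) (bounded_operatorZ bT).
  by rewrite (bounded_operatorD bS) (bounded_operatorZ bS) scalerDr addrACA.
exists (c + d) => v; rewrite (le_trans (ler_normD _ _)) // rmorphD mulrDl.
exact: lerD.
Qed.

Lemma bounded_operator_sub T S : bounded_operator T -> bounded_operator S ->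
  bounded_operator (fun v => T v - S v).
Proof.
move=> bT bS; have := bounded_operator_add bT (bounded_operator_scale (-1) bS).
by congr bounded_operator; apply/funext => v; rewrite scaleN1r.
Qed.

Lemma opnormP T v : bounded_operator T -> `|T v| <= (opnorm T)%:C * `|v|.
Proof.
move=> bT; have [->|v0] := eqVneq v 0.
  by rewrite (bounded_operator0 bT) !normr0 mulr0.
have nv0 : 0 < `|v| by rewrite normr_gt0.
have [c c0 cT] := bounded_operator_gt0 bT.
have normE (w : H) : (complex.Re `|w|)%:C = `|w| by rewrite RRe_real // normr_real.
rewrite -ler_pdivrMr //.
have -> : `|T v| / `|v| = `|T (`|v|^-1 *: v)|.
  by rewrite (bounded_operatorZ bT) normrZ normfV normr_id mulrC.
(* [sup] dominates its set only if that set is bounded above; the operator bound [c] provides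
   this. *)
rewrite -normE lecR; apply: ub_le_sup; last first.
  by exists (`|v|^-1 *: v) => //=; rewrite normrZ normfV normr_id mulVf ?gt_eqF.
exists c => _ [u /= u1 <-]; rewrite -lecR normE (le_trans (cT u)) //.
by rewrite ler_piMr // lecR ltW.
Qed.

End HilbertSpace.

(** * Inner product geometry and existence of adjoints *)

Section InnerProduct.
Variables (R : realType) (H : completeNormedModType R[i]).
Variables (dot : {dot H for Num.conj}) (dot_norm : hilbert_dot dot).
Local Notation C := R[i].
Implicit Types (u v w : H) (M N : set H) (T S Q : H -> H).

Lemma dotC u v : dot u v = (dot v u)^*%R.
Proof. by rewrite hermC /= expr0 mul1r. Qed.

Lemma dot_eq0C u v : dot u v = 0 -> dot v u = 0.
Proof. by rewrite [dot v u]dotC => ->; rewrite conjC0. Qed.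

Lemma dotZr (a : C) u v : dot u (a *: v) = a^*%R * dot u v.
Proof. by rewrite linearZr_LR. Qed.

Lemma dotZl (a : C) u v : dot (a *: u) v = a * dot u v.
Proof. by rewrite linearZl_LR. Qed.

Lemma dotDl u v w : dot (u + v) w = dot u w + dot v w.
Proof. exact: linearDl. Qed.

Lemma dotDr u v w : dot u (v + w) = dot u v + dot u w.
Proof. exact: linearDr. Qed.

Lemma dotNl u v : dot (- u) v = - dot u v.
Proof. exact: linearNl. Qed.

Lemma dotNr u v : dot u (- v) = - dot u v.
Proof. exact: linearNr. Qed.

Lemma dotBl u v w : dot (u - v) w = dot u w - dot v w.
Proof. exact: linearBl. Qed.

Lemma dotBr u v w : dot u (v - w) = dot u v - dot u w.
Proof. exact: linearBr. Qed.

Lemma dot0l u : dot 0 u = 0.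
Proof. exact: linear0l. Qed.

Lemma dot0r u : dot u 0 = 0.
Proof. exact: linear0r. Qed.

Lemma pythagoras u v : dot u v = 0 -> `|u + v| ^+ 2 = `|u| ^+ 2 + `|v| ^+ 2.
Proof.
move=> uv; rewrite !dot_norm dotDl !dotDr uv (dot_eq0C uv).
by rewrite addr0 add0r.
Qed.

Lemma norm_le_pythagoras u v : dot u v = 0 -> `|u| <= `|u + v|.
Proof.
move=> uv; rewrite -ler_sqr ?nnegrE // (pythagoras uv) lerDl.
by rewrite exprn_ge0.
Qed.

(** The projection [c *: v] of [u] onto the line of [v] is no longer than [u], by Pythagoras. *)
Lemma cauchy_schwarz u v : `|dot u v| <= `|u| * `|v|.
Proof.
have [->|v0] := eqVneq v 0; first by rewrite dot0r !normr0 mulr0.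
have nv0 : 0 < `|v| by rewrite normr_gt0.
have vv0 : dot v v != 0 by rewrite -dot_norm expf_neq0 // gt_eqF.
set c := dot u v / dot v v.
have orth : dot (c *: v) (u - c *: v) = 0.
  by apply: dot_eq0C; rewrite dotBl dotZr dotZr dotZl divfK // subrr.
have := norm_le_pythagoras orth; rewrite addrC subrK normrZ /c normrM normfV.
rewrite -dot_norm normrX normr_id expr2 invfM -!mulrA mulVf ?gt_eqF // mulr1.
by rewrite ler_pdivrMr.
Qed.

Lemma dot_inj v w : (forall u, dot u v = dot u w) -> v = w.
Proof.
move=> vw; apply/eqP; rewrite -subr_eq0 -normr_eq0 -sqrf_eq0 dot_norm.
by rewrite dotBr vw subrr.
Qed.

(** Both sides are linear and continuous in [u]. The relation $T^*v = w$ can therefore be tested on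
    basis vectors [u]. *)
Lemma closed_subspace_dot_eq T v w : bounded_operator T ->
  closed_subspace [set u | dot (T u) v = dot u w].
Proof.
move=> bT; split.
- move=> u /closure_normP uc /=; apply/eqP; rewrite -subr_eq0; apply/eqP.
  have [c c0 cT] := bounded_operator_gt0 bT.
  apply: (@norm_le_small_eq0 R C^o _ (c%:C * `|v| + `|w|)) => [|eps e0].
    by rewrite addr_ge0 // mulr_ge0 // ?lecR ltW // ltcR.
  have [u' /= u'E uu'] := uc _ e0.
  have -> : dot (T u) v - dot u w = dot (T (u - u')) v - dot (u - u') w.
    by rewrite (bounded_operatorB bT) !dotBl u'E opprB addrA subrK.
  rewrite (le_trans (ler_normB _ _)) // mulrDl lerD //.
    rewrite (le_trans (cauchy_schwarz _ _)) // mulrAC ler_wpM2r //.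
    by rewrite (le_trans (cT _)) // ler_pM2l ?ltcR // ltW.
  rewrite (le_trans (cauchy_schwarz _ _)) // mulrC ler_wpM2l //.
  exact: ltW.
- by rewrite /= (bounded_operator0 bT) !dot0l.
- move=> a u u' /= uE u'E; rewrite (bounded_operatorD bT) (bounded_operatorZ bT).
  by rewrite !dotDl !dotZl uE u'E.
Qed.

Lemma closed_subspace_orthogonal v : closed_subspace [set u | dot u v = 0].
Proof.
have := closed_subspace_dot_eq v 0 (@bounded_operator_id R H).
by congr closed_subspace; apply/seteqP; split => u /=; rewrite dot0r.
Qed.

(** Here [w] stands for $T^*v$. Testing with [u = w] gives $|w|^2 = \langle Tw, v\rangle \le
    c|w||v|$. *)
Lemma adjoint_vector_bound T : bounded_operator T ->
  exists2 c : R, 0 < c & forall v w, (forall u, dot (T u) v = dot u w) ->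
    `|w| <= c%:C * `|v|.
Proof.
move=> bT; have [c c0 cT] := bounded_operator_gt0 bT; exists c => // v w vw.
have [->|w0] := eqVneq w 0; first by rewrite normr0 mulr_ge0 // ltW // ltcR.
have nw0 : 0 < `|w| by rewrite normr_gt0.
rewrite -(ler_pM2l nw0) -expr2 mulrCA mulrA.
have -> : `|w| ^+ 2 = `|dot (T w) v| by rewrite vw -dot_norm normrX normr_id.
by rewrite (le_trans (cauchy_schwarz _ _)) // ler_wpM2r.
Qed.

(* Boundedness of T makes w depend continuously on v. *)
Lemma closed_subspace_adjointable T : bounded_operator T ->
  closed_subspace [set v | exists w, forall u, dot (T u) v = dot u w].
Proof.
move=> bT; have [c c0 cw] := adjoint_vector_bound bT.
have c0' : 0 < c%:C by rewrite ltcR.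
split.
- move=> v /closure_normP vc.
  pose r n : R := n.+1%:R^-1.
  have r0 n : 0 < (r n)%:C by rewrite ltcR invr_gt0.
  have {vc} /choice[vs vsP] : forall n, exists p : H * H,
      (forall u, dot (T u) p.1 = dot u p.2) /\ `|v - p.1| < (r n)%:C.
    by move=> n; have [v' [w vw] vv'] := vc _ (r0 n); exists (v', w).
  pose w n := (vs n).2.
  (* A difference of adjoint vectors is the adjoint vector of the difference, so [w] inherits the
     Cauchy property from the approximations of [v]; completeness then gives the limit [l]. *)
  have wB m n : `|w m - w n| <= c%:C * ((r m)%:C + (r n)%:C).
    have /cw/le_trans : forall u, dot (T u) ((vs m).1 - (vs n).1) = dot u (w m - w n).
      by move=> u; rewrite !dotBr (vsP m).1 (vsP n).1.
    apply; rewrite ler_pM2l // -(subrKA v) (le_trans (ler_normD _ _)) // lerD //.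
      by rewrite distrC ltW // (vsP m).2.
    by rewrite ltW // (vsP n).2.
  have small (eps : C) : 0 < eps -> \forall n \near \oo, (r n)%:C < eps.
    move=> e0; have eR : eps = (complex.Re eps)%:C.
      by rewrite RRe_real // gtr0_real.
    have e0' : 0 < complex.Re eps by rewrite -ltcR -eR.
    near=> n; rewrite eR ltcR /r.
    by near: n; exact: (near_infty_natSinv_lt (PosNum e0')).
  have /cauchy_cvg/cvg_ex[l wl] : cauchy (w @ \oo).
    apply: cauchy_exP => eps e0.
    have e1 : 0 < eps / c%:C / 2 by rewrite !divr_gt0.
    have [N _ Nr] := small _ e1; exists (w N).
    exists N => // n /= Nn; rewrite -ball_normE /ball_ /=.
    rewrite (le_lt_trans (wB _ _)) //.
    have -> : eps = c%:C * (eps / c%:C / 2 + eps / c%:C / 2).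
      by rewrite -splitr mulrC divfK // gt_eqF.
    by rewrite ltr_pM2l // ltrD // Nr //=.
  exists l => u; apply/eqP; rewrite -subr_eq0; apply/eqP.
  apply: (@norm_le_small_eq0 R C^o _ (`|T u| + `|u|)) => [|eps e0].
    by rewrite addr_ge0.
  have : \forall n \near \oo, (r n)%:C < eps /\ `|l - w n| < eps.
    near=> n; split; first by near: n; exact: small.
    by near: n; by apply: (@cvgr_dist_lt _ _ _ \oo _ w l wl).
  move=> /filter_ex[n [rn wn]].
  (* The inserted terms cancel because [w n] is the adjoint vector of the approximation
     [(vs n).1]. *)
  have -> : dot (T u) v - dot u l = dot (T u) (v - (vs n).1) - dot u (l - w n).
    by rewrite !dotBr (vsP n).1 opprB addrA subrK.
  rewrite (le_trans (ler_normB _ _)) // mulrDl lerD //.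
    rewrite (le_trans (cauchy_schwarz _ _)) // ler_wpM2l //.
    by rewrite ltW // (lt_trans (vsP n).2).
  by rewrite (le_trans (cauchy_schwarz _ _)) // ler_wpM2l // ltW.
- by exists 0 => u; rewrite !dot0r.
- move=> a v v' [w vw] [w' vw']; exists (a *: w + w') => u.
  by rewrite !dotDr !dotZr vw vw'.
Unshelve. all: by end_near.
Qed.

(** Adjoint vectors are chosen pointwise; their uniqueness makes the choice linear, and the uniform
    bound makes it bounded. *)
Lemma adjoint_exists T : bounded_operator T ->
  [set v | exists w, forall u, dot (T u) v = dot u w] = setT ->
  exists2 S, bounded_operator S & is_adjoint dot T S.
Proof.
move=> bT adjT; have [c c0 cw] := adjoint_vector_bound bT.
have /choice[S SP] : forall v, exists w, forall u, dot (T u) v = dot u w.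
  by move=> v; have : [set: H] v by []; rewrite -adjT.
exists S; last by move=> u v; rewrite SP.
split; last by exists c => v; exact: cw.
by move=> a u v; apply: dot_inj => w; rewrite -SP !dotDr !dotZr !SP.
Qed.

End InnerProduct.

(** * Coordinate subspaces of an orthonormal basis *)

Section OrthonormalBasis.
Variables (R : realType) (H : completeNormedModType R[i]).
Variables (dot : {dot H for Num.conj}) (dot_norm : hilbert_dot dot).
Variables (X : countType) (e : X -> H) (e_basis : complete_orthonormal dot e).
Local Notation C := R[i].
Implicit Types (u v w : H) (M N : set H) (T S Q : H -> H) (K L : set X).

Lemma dot_basis x y : dot (e x) (e y) = (x == y)%:R.
Proof. by case: e_basis => ->. Qed.

Lemma norm_basis x : `|e x| = 1.
Proof.
by apply/eqP; rewrite -(@eqrXn2 _ 2) // expr1n dot_norm dot_basis eqxx.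
Qed.

(** Density principle: a closed linear condition need only be verified on the basis. *)
Lemma basis_total M : closed_subspace M -> (forall x, M (e x)) -> M = setT.
Proof.
move=> sM Me; rewrite -subTset; case: e_basis => _ <-.
by apply: closure_lspan_sub => // _ [x _ <-].
Qed.

Lemma basis_approx v (eps : C) : 0 < eps ->
  exists n (a : 'I_n -> C) (x : 'I_n -> X),
    `|v - \sum_(i < n) a i *: e (x i)| < eps.
Proof.
move=> e0; have : [set: H] v by [].
case: e_basis => _ <- /closure_normP/(_ _ e0)[_ [n [a [u [ue ->]]]] vu].
have {ue}/choice[x xu] : forall i, exists x, e x = u i.
  by move=> i; have [x _ <-] := ue i; exists x.
by exists n, a, x; under eq_bigr do rewrite xu.
Qed.

(* The distance from v to a combination of basis vectors does not increase
   when the terms orthogonal to v are dropped. *)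
Lemma coordinate_subspaceP K v :
  coordinate_subspace e K v <-> forall x, ~ K x -> dot v (e x) = 0.
Proof.
split=> [Kv x Kx|vK].
  apply: (closure_lspan_sub (closed_subspace_orthogonal dot_norm (e x)) _ Kv).
  move=> _ [y Ky <-] /=; rewrite dot_basis; case: eqP => // yx.
  by case: Kx; rewrite -yx.
apply/closure_normP => eps e0; have [n [a [x vx]]] := basis_approx v e0.
pose I := [set i : 'I_n | `[< K (x i) >]]%SET.
exists (\sum_(i in I) a i *: e (x i)).
  exists #|I|, (a \o enum_val), (e \o x \o enum_val); split => [i|] /=.
    exists (x (enum_val i)) => //; apply/asboolP.
    by have := enum_valP i; rewrite inE.
  by rewrite big_enum_val.
apply: le_lt_trans vx; rewrite [in leRHS](bigID (mem I)) /= opprD addrA.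
apply: (norm_le_pythagoras dot_norm).
(* For a dropped index [j], [x j] lies outside [K]: [v] has coordinate zero there, and every kept
   [e (x i)] is orthogonal to [e (x j)]. *)
rewrite dotNr linear_sumr big1 ?oppr0 // => j jI /=.
rewrite dotZr dotBl vK ?sub0r; last by move/asboolP; rewrite inE in jI; apply/negP.
rewrite linear_sumlz big1 ?oppr0 ?mulr0 // => i iI /=.
rewrite dotZl dot_basis; case: eqP => [xij|]; last by rewrite mulr0.
by move: jI iI; rewrite !inE xij => /negP jI iI; case: jI; exact/asboolP.
Qed.

Lemma closed_subspace_coordinate K : closed_subspace (coordinate_subspace e K).
Proof.
split.
- exact: closed_closure.
- by apply/coordinate_subspaceP => x _; rewrite dot0l.
- move=> a u v /coordinate_subspaceP Ku /coordinate_subspaceP Kv.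
  by apply/coordinate_subspaceP => x Kx; rewrite dotDl dotZl Ku // Kv // mulr0 addr0.
Qed.

Lemma coordinate_subspace_basis K x : coordinate_subspace e K (e x) <-> K x.
Proof.
rewrite coordinate_subspaceP; split=> [Kx|Kx y Ky].
  apply: contrapT => /Kx/eqP; rewrite dot_basis eqxx oner_eq0.
  by [].
by rewrite dot_basis; case: eqP => // xy; case: Ky; rewrite -xy.
Qed.

Lemma coordinate_subspace_sub K M :
  closed_subspace M -> (forall x, K x -> M (e x)) -> coordinate_subspace e K `<=` M.
Proof. by move=> sM KM; apply: closure_lspan_sub => // _ [x Kx <-]; exact: KM. Qed.

Lemma coordinate_subspace_mono K L :
  K `<=` L -> coordinate_subspace e K `<=` coordinate_subspace e L.
Proof.
move=> KL; apply: coordinate_subspace_sub; first exact: closed_subspace_coordinate.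
by move=> x /KL Lx; apply/coordinate_subspace_basis.
Qed.

(** [K] is recovered from its subspace as the set of [x] whose [e x] belongs to it. *)
Lemma coordinate_subspace_inj : injective (coordinate_subspace e).
Proof.
move=> K L KL; apply/seteqP.
split=> x /coordinate_subspace_basis Kx; apply/coordinate_subspace_basis.
  by rewrite -KL.
by rewrite KL.
Qed.

Lemma coordinate_subspace_set0 : coordinate_subspace e set0 = [set 0].
Proof.
apply/seteqP; split; last by move=> _ ->; case: (closed_subspace_coordinate set0).
by apply: coordinate_subspace_sub => //; exact: closed_subspace_set0.
Qed.

Lemma coordinate_subspace_orthogonal K v w : coordinate_subspace e K v ->
  coordinate_subspace e (~` K) w -> dot w v = 0.
Proof.
move=> /coordinate_subspaceP Kv.
apply: (coordinate_subspace_sub (closed_subspace_orthogonal dot_norm v)) => x Kx /=.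
by apply: dot_eq0C; exact: Kv.
Qed.

(** For [x] outside [K], the coordinate of [S v] at [x] is conjugate to $\langle Te_x, v\rangle$,
    which vanishes since $Te_x$ stays in the subspace of the complement. *)
Lemma adjoint_image_coordinate K T S : is_adjoint dot T S ->
  T @` coordinate_subspace e (~` K) `<=` coordinate_subspace e (~` K) ->
  S @` coordinate_subspace e K `<=` coordinate_subspace e K.
Proof.
move=> TS TK _ [v Kv <-]; apply/coordinate_subspaceP => x Kx.
apply: dot_eq0C; rewrite -TS; apply: (coordinate_subspace_orthogonal Kv).
by apply: TK; exists (e x) => //; apply/coordinate_subspace_basis.
Qed.

Lemma image_coordinate K T : bounded_operator T ->
  (forall x, K x -> coordinate_subspace e K (T (e x))) ->
  T @` coordinate_subspace e K `<=` coordinate_subspace e K.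
Proof.
move=> bT TK _ [v Kv <-]; move: v Kv.
apply: coordinate_subspace_sub => //.
by apply: closed_subspace_preimage => //; exact: closed_subspace_coordinate.
Qed.

(* The condition on the complement makes this set stable under adjoints without
   appealing to their existence. *)
Definition preserving (K : set X) : set (H -> H) :=
  [set T | [/\ bounded_operator T,
    T @` coordinate_subspace e K `<=` coordinate_subspace e K &
    T @` coordinate_subspace e (~` K) `<=` coordinate_subspace e (~` K)]].

Lemma image_limit M T : closed_subspace M -> bounded_operator T ->
  (forall eps : R, 0 < eps -> exists S, [/\ bounded_operator S, S @` M `<=` M &
    opnorm (fun v => T v - S v) < eps]) -> T @` M `<=` M.
Proof.
move=> sM bT TM _ [v Mv <-]; apply: closed_subspace_limit => // eps e0.
have eR : eps = (complex.Re eps)%:C by rewrite RRe_real // gtr0_real.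
have vR : `|v| = (complex.Re `|v|)%:C by rewrite RRe_real // normr_real.
(* Adding 1 keeps the denominator positive when [v = 0]. *)
have v0 : 0 < complex.Re `|v| + 1.
  by rewrite ltr_wpDl // -lecR -vR; exact: normr_ge0.
have e1 : 0 < complex.Re eps / (complex.Re `|v| + 1).
  by rewrite divr_gt0 // -ltcR -eR.
have [S [bS SM TS]] := TM _ e1; exists (S v); first by apply: SM; exists v.
apply: le_lt_trans (opnormP v (bounded_operator_sub bT bS)) _.
rewrite eR vR -rmorphM ltcR.
have [->|nv0] := eqVneq (complex.Re `|v|) 0.
  by rewrite mulr0 -ltcR -eR.
have {}nv0 : 0 < complex.Re `|v| by rewrite lt_def nv0 -lecR -vR; exact: normr_ge0.
rewrite -ltr_pdivlMr // (lt_trans TS) // ltr_pM2l -?ltcR -?eR //.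
by rewrite ltcR ltf_pV2 ?posrE // ltrDl.
Qed.

(** Algebraic operations and norm limits keep each of the two subspaces stable; passing to the
    adjoint exchanges the roles of [K] and its complement. *)
Lemma cstar_subalgebra_preserving K : cstar_subalgebra dot (preserving K).
Proof.
have sK L := closed_subspace_coordinate L.
split.
- by move=> T [].
- have b0 : bounded_operator (fun=> 0 : H).
    split; first by move=> a u v; rewrite scaler0 addr0.
    by exists 0 => v; rewrite mul0r normr0.
  by split=> // _ [v _ <-]; case: (sK K) (sK (~` K)) => _ + _ [_ + _].
- move=> S T [bS SK SK'] [bT TK TK']; split; first exact: bounded_operator_add.
    by move=> _ [v Kv <-]; apply: (closed_subspaceD (sK _)); [apply: SK|apply: TK]; exists v.
  by move=> _ [v Kv <-]; apply: (closed_subspaceD (sK _)); [apply: SK'|apply: TK']; exists v.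
- move=> a T [bT TK TK']; split; first exact: bounded_operator_scale.
    by move=> _ [v Kv <-]; apply: (closed_subspaceZ _ (sK _)); apply: TK; exists v.
  by move=> _ [v Kv <-]; apply: (closed_subspaceZ _ (sK _)); apply: TK'; exists v.
- move=> S T [bS SK SK'] [bT TK TK']; split; first exact: bounded_operator_comp.
    by move=> _ [v Kv <-]; apply: SK; exists (T v) => //; apply: TK; exists v.
  by move=> _ [v Kv <-]; apply: SK'; exists (T v) => //; apply: TK'; exists v.
- move=> T S [bT TK TK'] bS TS; split => //.
    exact: adjoint_image_coordinate TS TK'.
  by apply: (adjoint_image_coordinate TS); rewrite setCK.
- move=> T bT TA; split => //; apply: image_limit => // eps /TA[S [bS SK SK'] TS];
    by exists S.
Qed.

(* Q is the orthogonal projection onto the span of the basis vectors it fixes. *)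
Lemma basis_projection_contractive Q v : bounded_operator Q ->
  (forall x, Q (e x) = e x \/ Q (e x) = 0) -> `|Q v| <= `|v|.
Proof.
move=> bQ Qe; have sO w := closed_subspace_orthogonal dot_norm w.
(* [Q u] and [u] have the same coordinate at a fixed basis vector. On the basis, the only danger is
   [e x] being killed, which its norm 1 excludes. *)
have fixed x : Q (e x) = e x -> forall u, dot (Q u - u) (e x) = 0.
  move=> Qx u; have bQ1 := bounded_operator_sub bQ (@bounded_operator_id R H).
  have sM := closed_subspace_preimage bQ1 (sO (e x)).
  have : [set: H] u by []; rewrite -(basis_total sM) // => y /=.
  have [Qy|Qy] := Qe y; rewrite Qy; first by rewrite subrr dot0l.
  rewrite sub0r dotNl dot_basis; case: eqP => [yx|]; last by rewrite oppr0.
  by have := norm_basis x; rewrite -Qx -yx Qy normr0 => /esym/eqP; rewrite oner_eq0.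
(* The first [v] is expanded along the basis: killed vectors contribute nothing, and fixed ones are
   covered by [fixed]. *)
have orth : dot (Q v) (Q v - v) = 0.
  have sM := closed_subspace_preimage bQ (sO (Q v - v)).
  have : [set: H] v by []; rewrite -(basis_total sM) // => y /=.
  have [Qy|->] := Qe y; last by rewrite dot0l.
  by rewrite Qy; apply: dot_eq0C; exact: fixed.
have : dot (Q v) (v - Q v) = 0 by rewrite -opprB dotNr orth oppr0.
by move=> /(norm_le_pythagoras dot_norm); rewrite addrC subrK.
Qed.

End OrthonormalBasis.

(** * Invariant sets and itineraries *)

Lemma f_invariantC (X : countType) (f : X -> X) (K : set X) :
  f_invariant f K -> f_invariant f (~` K).
Proof.
move=> [fK Kf]; split; first by move=> _ [x Kx <-] /Kf.
by move=> x Kfx Kx; apply: Kfx; apply: fK; exists x.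
Qed.

Section Itineraries.
Variables (X : countType) (f : X -> X) (k : nat) (P : bounded_partition f k).

Lemma piece_indexP x : P (piece_index P x) x.
Proof. by rewrite /piece_index; case: cid. Qed.

Lemma piece_indexE x i : P i x -> piece_index P x = i.
Proof.
move=> Pix; apply: (piece_disjoint (b := P)) => //.
by exists x; split => //; exact: piece_indexP.
Qed.

Definition same_prefix n x y :=
  forall j, (j < n)%N -> itinerary P x j = itinerary P y j.

(** The itinerary of [f x] is the shift of that of [x]; this drives the induction on prefixes. *)
Lemma same_prefixS n x y : same_prefix n.+1 x y <->
  piece_index P x = piece_index P y /\ same_prefix n (f x) (f y).
Proof.
split=> [xy|[xy fxy] [|j] // jn].
  split; first exact: (xy 0%N).
  by move=> j jn; have := xy j.+1 jn; rewrite /itinerary !iterSr.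
by rewrite /itinerary !iterSr; exact: fxy.
Qed.

(** Each [z i] other than [x] departs from the itinerary of [x] at some finite index, and the
    maximum over finitely many [i] serves them all. *)
Lemma totally_unique_separates (uniq_f : totally_unique P) n (z : 'I_n -> X) x :
  exists N, forall i, same_prefix N x (z i) -> z i = x.
Proof.
have /choice[m mP] : forall i, exists m, same_prefix m x (z i) -> z i = x.
  move=> i; apply: contrapT => noN; apply: noN.
  have [zx|zx] := pselect (z i = x); first by exists 0%N.
  have [m xm] : exists m, itinerary P x m <> itinerary P (z i) m.
    apply/not_existsP => xz; apply: zx; apply/esym/uniq_f/funext => j.
    by apply: contrapT; exact: xz.
  (* A prefix of length [m.+1] is the shortest one that includes index [m]. *)
  by exists m.+1 => /(_ m (ltnSn m)).
exists (\max_i m i) => i xz; apply: mP => j jm; apply: xz.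
exact: leq_trans jm (leq_bigmax i).
Qed.

End Itineraries.

(** * The associated partial isometries and their adjoints *)

Section AssociatedOperators.
Variables (R : realType) (H : completeNormedModType R[i]).
Variables (dot : {dot H for Num.conj}) (dot_norm : hilbert_dot dot).
Variables (X : countType) (e : X -> H) (e_basis : complete_orthonormal dot e).
Variables (f : X -> X) (k : nat) (P : bounded_partition f k).
Variables (T : 'I_k -> H -> H) (T_assoc : associated_operators e P T).
Local Notation CT := (Cstar dot (range T)).

Lemma associated_bounded i : bounded_operator (T i).
Proof. by case: (T_assoc i). Qed.

Lemma associated_in i x : P i x -> T i (e x) = e (f x).
Proof. by case: (T_assoc i) => _ /(_ x)[+ _]. Qed.

Lemma associated_out i x : ~ P i x -> T i (e x) = 0.
Proof. by case: (T_assoc i) => _ /(_ x)[_ +]. Qed.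

(** This is $T_i^*e_{f(x)} = e_x$ in weak form. It rests on injectivity of [f] on the piece: among
    its points only [x] is sent to [f x]. *)
Lemma associated_adjoint_in i x u : P i x -> dot (T i u) (e (f x)) = dot u (e x).
Proof.
move=> Pix; have sM := closed_subspace_dot_eq dot_norm (e (f x)) (e x) (associated_bounded i).
have : [set: H] u by []; rewrite -(basis_total e_basis sM) // => z /=.
have [Piz|Piz] := pselect (P i z).
  rewrite associated_in // !(dot_basis e_basis); congr (_%:R); congr nat_of_bool.
  by apply/eqP/eqP => [|->//]; apply: (piece_inj (b := P) (i := i)); rewrite inE.
rewrite associated_out // dot0l (dot_basis e_basis); case: eqP => // zx.
by case: Piz; rewrite zx.
Qed.

Lemma associated_adjoint_out i y u :
  ~ (f @` P i) y -> dot (T i u) (e y) = dot u 0.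
Proof.
move=> Piy; have sM := closed_subspace_dot_eq dot_norm (e y) 0 (associated_bounded i).
have : [set: H] u by []; rewrite -(basis_total e_basis sM) // => z /=.
rewrite dot0r; have [Piz|Piz] := pselect (P i z).
  rewrite associated_in // (dot_basis e_basis); case: eqP => // fzy.
  by case: Piy; exists z.
by rewrite associated_out // dot0l.
Qed.

(** Every [e y] has an adjoint vector: [e x] if [y = f x] with [x] in the piece, and 0 otherwise.
    Closedness extends this to all of [H]. *)
Lemma associated_adjoint i : exists S, [/\ bounded_operator S,
  is_adjoint dot (T i) S & forall x, P i x -> S (e (f x)) = e x].
Proof.
have bT := associated_bounded i.
have [|S bS TS] := adjoint_exists dot_norm bT.
  apply: (basis_total e_basis); first exact: closed_subspace_adjointable.
  move=> y; have [[x Pix <-]|Piy] := pselect ((f @` P i) y).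
    by exists (e x) => u; exact: associated_adjoint_in.
  by exists 0 => u; exact: associated_adjoint_out.
exists S; split => // x Pix; apply: (dot_inj dot_norm) => u.
by rewrite -TS; exact: associated_adjoint_in.
Qed.

(** The generators preserve the subspaces of [K] and of its complement, both sets being invariant;
    minimality of the generated algebra extends this to all its elements. *)
Lemma coordinate_subspace_reducing (K : set X) :
  f_invariant f K -> reducing_subspace dot CT (coordinate_subspace e K).
Proof.
move=> invK; have KT : CT `<=` preserving e K.
  apply: smallest_sub; first exact: cstar_subalgebra_preserving.
  have TK i L : f_invariant f L ->
      T i @` coordinate_subspace e L `<=` coordinate_subspace e L.
    move=> [fL _]; apply: (image_coordinate dot_norm e_basis) => [|x Lx].
      exact: associated_bounded.
    have [Pix|Pix] := pselect (P i x).
      rewrite associated_in //; apply/(coordinate_subspace_basis dot_norm e_basis).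
      by apply: fL; exists x.
    rewrite associated_out //.
    by case: (closed_subspace_coordinate dot_norm e_basis L).
  move=> _ [i _ <-]; split; first exact: associated_bounded.
    exact: TK.
  by apply: TK; exact: f_invariantC.
split; first exact: closed_subspace_coordinate.
move=> A /KT[bA AK AK']; split => // S _ AS.
exact: (adjoint_image_coordinate dot_norm e_basis AS AK').
Qed.

(** * Reducing subspaces and prefix projections *)

Section ReducingSubspace.
Variables (M : set H) (redM : reducing_subspace dot CT M).

Lemma reducing_associated i v : M v -> M (T i v).
Proof.
move=> Mv; have [|TM _] := redM.2 (T i); last by apply: TM; exists v.
by apply: sub_gen_smallest; exists i.
Qed.

Lemma reducing_adjoint i S v :
  bounded_operator S -> is_adjoint dot (T i) S -> M v -> M (S v).
Proof.
move=> bS TS Mv; have [|_ /(_ S bS TS) SM] := redM.2 (T i).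
  by apply: sub_gen_smallest; exists i.
by apply: SM; exists v.
Qed.

(* Q is T_w^* T_w for the word w formed by the first n terms of the itinerary
   of x. *)
Lemma prefix_projection n x : exists Q, [/\ bounded_operator Q,
  forall v, M v -> M (Q v),
  forall z, same_prefix P n x z -> Q (e z) = e z &
  forall z, ~ same_prefix P n x z -> Q (e z) = 0].
Proof.
elim: n x => [|n IHn] x.
  exists id; split => //; first exact: bounded_operator_id.
  by move=> z [].
set i := piece_index P x; have [Q [bQ QM Q1 Q0]] := IHn (f x).
have [S [bS TS Sf]] := associated_adjoint i; have bT := associated_bounded i.
(* [T i] tests the first letter and shifts to [f x], [Q] tests the remaining [n] letters, and the
   adjoint [S] undoes the shift. *)
exists (S \o (Q \o T i)); split => [|v Mv|z|z] /=.
- by do 2 apply: bounded_operator_comp => //.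
- by apply: reducing_adjoint TS _ => //; apply: QM; exact: reducing_associated.
- move=> /same_prefixS[xz fxz].
  have Piz : P i z by rewrite /i xz; exact: piece_indexP.
  by rewrite associated_in // Q1 // Sf.
- move=> xz; have [Piz|Piz] := pselect (P i z).
    rewrite associated_in // Q0 ?(bounded_operator0 bS) // => fxz; apply: xz.
    by apply/same_prefixS; split => //; rewrite (piece_indexE Piz).
  by rewrite associated_out // (bounded_operator0 bQ) (bounded_operator0 bS).
Qed.

(* Projections onto longer and longer prefixes converge strongly to the
   projection onto e x. *)
Lemma reducing_basis_component (uniq_f : totally_unique P) v x :
  M v -> M (dot v (e x) *: e x).
Proof.
move=> Mv; case: (redM) => sM _; apply: closed_subspace_limit => // eps e0.
have [n [a [z vz]]] := basis_approx e_basis v (divr_gt0 e0 (ltr0n _ 2)).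
set u := \sum_(i < n) _ in vz.
(* [N] is long enough for the projection to kill every term of [u] not at [x], so [Q u] is exactly
   the component of [u] along [e x]. *)
have [N NP] := totally_unique_separates uniq_f z x.
have [Q [bQ QM Q1 Q0]] := prefix_projection N x.
exists (Q v); first exact: QM.
have Qu : Q u = dot u (e x) *: e x.
  rewrite (bounded_operator_sum bQ) linear_sumlz scaler_suml.
  apply: eq_bigr => i _; rewrite /= dotZl (dot_basis e_basis).
  have [<-|zx] := eqVneq x (z i); first by rewrite Q1 ?eqxx ?mulr1.
  rewrite Q0 ?scaler0; last by move=> /NP/esym/eqP; rewrite (negbTE zx).
  by rewrite mulr0 scale0r.
(* The contributions of [u] cancel. Each remaining term is at most [|v - u| < eps / 2], by
   Cauchy-Schwarz and by contractivity of [Q]. *)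
have -> : dot v (e x) *: e x - Q v = dot (v - u) (e x) *: e x - Q (v - u).
  by rewrite (bounded_operatorB bQ) Qu dotBl scalerBl opprB addrA subrK.
rewrite (le_lt_trans (ler_normB _ _)) // [eps]splitr ltrD //.
  rewrite normrZ (norm_basis dot_norm e_basis) mulr1.
  rewrite (le_lt_trans (cauchy_schwarz dot_norm _ _)) //.
  by rewrite (norm_basis dot_norm e_basis) mulr1.
apply: le_lt_trans vz.
apply: (basis_projection_contractive dot_norm e_basis _ bQ) => y.
by have [xy|xy] := pselect (same_prefix P N x y); [left; exact: Q1|right; exact: Q0].
Qed.

(** With [i] the piece of [x], [T i] carries [e x] to [e (f x)] and its adjoint carries it back,
    giving the forward and backward inclusions. *)
Lemma reducing_basis_invariant : f_invariant f [set x | M (e x)].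
Proof.
split=> [_ [x Mx <-]|x] /=.
  by rewrite -(associated_in (piece_indexP P x)); exact: reducing_associated.
have [S [bS TS Sf]] := associated_adjoint (piece_index P x).
move=> Mfx; rewrite -(Sf x (piece_indexP P x)).
exact: reducing_adjoint TS Mfx.
Qed.

Lemma reducing_coordinate_subspace (uniq_f : totally_unique P) :
  coordinate_subspace e [set x | M (e x)] = M.
Proof.
case: (redM) => sM _; apply/seteqP; split.
  exact: coordinate_subspace_sub.
move=> v Mv; apply/(coordinate_subspaceP dot_norm e_basis) => x /= Mx.
(* A nonzero coordinate can be divided out of the component of [v] along [e x], which lies in
   [M]. *)
apply: contrapT => /eqP vx; apply: Mx.
rewrite -[e x](scalerK vx); apply: closed_subspaceZ => //.
exact: reducing_basis_component.
Qed.

End ReducingSubspace.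

End AssociatedOperators.

(** * The correspondence between invariant sets and reducing subspaces *)

Theorem theorem4p3 (R : realType) (X : countType) (f : X -> X)
    (k : nat) (k_gt0 : (0 < k)%N) (P : bounded_partition f k)
    (H : completeNormedModType R[i]) (dot : {dot H for Num.conj})
    (dot_norm : hilbert_dot dot)
    (e : X -> H) (e_basis : complete_orthonormal dot e)
    (T : 'I_k -> H -> H) (T_assoc : associated_operators e P T)
    (uniq_f : totally_unique P) :
  set_bij [set K : set X | f_invariant f K]
          [set M : set H | reducing_subspace dot (Cstar dot (range T)) M]
          (coordinate_subspace e) /\
  (forall K L : set X, f_invariant f K -> f_invariant f L -> K `<=` L ->
     coordinate_subspace e K `<=` coordinate_subspace e L) /\
  coordinate_subspace e set0 = [set 0].
Proof.
split; last split.
- split.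
  + by move=> K; exact: coordinate_subspace_reducing.
  + by move=> K L _ _; exact: coordinate_subspace_inj.
  + move=> M redM; exists [set x | M (e x)].
      exact: reducing_basis_invariant redM.
    exact: reducing_coordinate_subspace.
- by move=> K L _ _; exact: coordinate_subspace_mono.
- exact: coordinate_subspace_set0.
Qed.
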